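(* For every $n\ge 2$, the biEulerian polynomial satisfies \[ \frac{B_n(x)}{(1-x)^{2n+1}}=\sum_{k\ge0}\binom{k+2}{2}^n x^k . \]
   Context: A bipermutation of $[n]$ is a sequence $\mathsf{B}=b_1|\cdots|b_{2n-1}$ of elements of $[n]$ in which one element $k=k(\mathsf{B})$ appears exactly once and every other element appears exactly twice. Write first occurrences of each $i\ne k$ as $i$ and second occurrences as $\overline i$; the single occurrence of $k$ is regarded as $k$ when compared with an unbarred letter and as $\overline k$ when compared with a barred letter. Two consecutive letters $i|j$ form a descent if (a) both are unbarred and $i>j$; or (b) both are barred and $i<j$ (comparing underlying numbers); or (c) $i$ is an unbarred element of $[n]\setminus\{k\}$, $j$ is a barred letter $\overline{j'}$ with $j'\ne k$, and $i>k$; or (d) $i$ is barred with $i\ne\overline k$, $j$ is an unbarred element of $[n]\setminus\{k\}$, and $j<k$. The biEulerian polynomial is $B_n(x)=\sum_{i=0}^{2n-2}b(n,i)x^i$, where $b(n,i)$ is the number of bipermutations of $[n]$ with exactly $i$ descents. *)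

(* Defs.v *)
From HB Require Import structures.
From mathcomp Require Import all_boot all_order all_algebra.

Set Implicit Arguments.
Unset Strict Implicit.
Unset Printing Implicit Defensive.

Import GRing.Theory.
Local Open Scope ring_scope.

(* The alphabet [n] = {1, ..., n} is 'I_n = {0, ..., n-1}: letters are only
   ever compared with one another. *)

Section Bipermutations.

Variable n : nat.
Implicit Types (k i j : 'I_n) (B : n.*2.-1.-tuple 'I_n).

Definition is_biperm B : bool :=
  [exists k, (count_mem k B == 1%N)
             && [forall i, (i != k) ==> (count_mem i B == 2%N)]].

Definition single_letter B : option 'I_n := [pick k | count_mem k B == 1%N].

(* Whether consecutive letters i | j, whose underlying values are i and j, form
   a descent; bi (resp. bj) tells that i (resp. j) is a second occurrence, i.e.,
   carries a bar. The letter k takes its bar from the letter it is compared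
   with, whence ci and cj. *)
Definition descent_pair k i (bi : bool) j (bj : bool) : bool :=
  let ci := if i == k then bj else bi in
  let cj := if j == k then bi else bj in
  [|| [&& ~~ ci, ~~ cj & (j < i)%N],
      [&& ci, cj & (i < j)%N],
      [&& i != k, ~~ bi, j != k, bj & (k < i)%N]
    | [&& i != k, bi, j != k, ~~ bj & (j < k)%N]].

(* The default value k of nth is never used: positions are in range below. *)
Definition barred_at k B (p : nat) : bool := nth k B p \in take p B.

Definition descent_at k B (p : nat) : bool :=
  descent_pair k (nth k B p) (barred_at k B p)
                 (nth k B p.+1) (barred_at k B p.+1).

(* The value 0 in the None case is irrelevant: it does not occur for a
   bipermutation. *)
Definition descents B : nat :=
  if single_letter B is Some k then
    #|[set p : 'I_(n.*2.-2) | descent_at k B p]|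
  else 0%N.

End Bipermutations.

Definition biEulerian_number (n i : nat) : nat :=
  #|[set B : n.*2.-1.-tuple 'I_n | is_biperm B & descents B == i]|.

Definition biEulerian (n : nat) : {poly int} :=
  \poly_(i < n.*2.-1) (biEulerian_number n i)%:R.

(* Formal power series over R, as coefficient sequences. *)

Section PowerSeries.

Variable R : unitRingType.

Definition fps : Type := nat -> R.

Implicit Types (f g : fps) (m : nat).

Definition fps_of_poly (p : {poly R}) : fps := fun m => p`_m.

Definition fps_one : fps := fun m => (m == 0%N)%:R.

Definition fps_mul f g : fps := fun m => \sum_(i < m.+1) f i * g (m - i)%N.

(* The first m coefficients of 1 / g, computed by solving g * h = 1. *)
Fixpoint fps_inv_seq g m : seq R :=
  if m is m'.+1 then
    let s := fps_inv_seq g m' in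
    rcons s ((g 0%N)^-1 *
             ((m' == 0%N)%:R - \sum_(i < m') g (m' - i)%N * s`_i))
  else [::].

Definition fps_inv g : fps := fun m => (fps_inv_seq g m.+1)`_m.

Definition fps_div f g : fps := fps_mul f (fps_inv g).

Lemma size_fps_inv_seq g m : size (fps_inv_seq g m) = m.
Proof. by elim: m => //= m IHm; rewrite size_rcons IHm. Qed.

Lemma nth_fps_inv_seq g m i :
  (i < m)%N -> (fps_inv_seq g m)`_i = fps_inv g i.
Proof.
elim: m => // m IHm; rewrite ltnS leq_eqVlt => /predU1P[-> // | lt_im].
by rewrite /= nth_rcons size_fps_inv_seq lt_im IHm.
Qed.

Lemma fps_mulfV g : g 0%N \is a GRing.unit -> fps_mul g (fps_inv g) =1 fps_one.
Proof.
move=> g0U m; rewrite /fps_mul (reindex_inj rev_ord_inj) /= big_ord_recr /=.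
rewrite subSS subnn subn0.
have -> : fps_inv g m = (g 0%N)^-1 *
    ((m == 0%N)%:R - \sum_(i < m) g (m - i)%N * fps_inv g i).
  rewrite {1}/fps_inv /= nth_rcons size_fps_inv_seq ltnn eqxx.
  by congr (_ * (_ - _)); apply: eq_bigr => i _; rewrite nth_fps_inv_seq.
rewrite mulVKr //.
under eq_bigr => i _ do rewrite subSS subKn 1?ltnW //.
by rewrite addrC subrK.
Qed.

End PowerSeries.

(* Main.v *)
Require Import Defs.
From mathcomp Require Import all_boot all_order all_algebra zify.

(* For each [m], the functions [f : i |-> (x_i, z_i)] from [n] to the pairs with
   [x_i + z_i <= m], of which there are ['C(m + 2, 2) ^ n], correspond to the
   pairs of a bipermutation [B] and a weakly increasing sequence
   [w_0 <= ... <= w_{2n-1} <= m] that is strict at each descent of [B]; there are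
   ['C(m - des B + 2n, 2n)] such sequences for a given [B], which is the
   coefficient of [x^m] in [x^(des B) / (1 - x)^(2n+1)]. Given [f], the last term
   of [w] is [M = max_i (x_i + z_i)], the letter [k] of [B] is the last index
   where the maximum is attained, the first occurrence of [i] is placed at time
   [x_i] and its second one at time [M - z_i], which is the same moment for [k];
   the descent rule is exactly what breaks the ties between simultaneous
   letters in a unique way. *)

Set Implicit Arguments.
Unset Strict Implicit.
Unset Printing Implicit Defensive.

Import GRing.Theory.
Local Open Scope nat_scope.

(** * Counting pairs of bounded sum and sequences with prescribed strict steps *)

Lemma card_le_sum_pairs (m : nat) :
  #|[set c : 'I_m.+1 * 'I_m.+1 | c.1 + c.2 <= m]| = 'C(m + 2, 2).
Proof.
rewrite addn2 -bin2_sum -sum1dep_card big_mkord.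
rewrite -(pair_big_dep predT (fun i j : 'I_m.+1 => i + j <= m) (fun _ _ => 1)).
(* After the reversal the first coordinate is [m - i], which leaves exactly [i + 1] choices for the
   second. *)
rewrite big_ord_recl add0n (reindex_inj rev_ord_inj) /=.
apply: eq_bigr => i _; rewrite sum1dep_card.
have widen_inj : injective (widen_ord (ltn_ord i)).
  by move=> j1 j2 /(congr1 val) /= /val_inj.
rewrite -[RHS]card_ord -[RHS](card_imset _ widen_inj).
apply: eq_card => j; rewrite !inE; apply/idP/imsetP => [le_ij|[j' _ ->]] /=.
  have lt_ji : j < i.+1 by have := ltn_ord i; rewrite /bump /=; lia.
  by exists (Ordinal lt_ji); rewrite ?inE //; apply: val_inj.
by have := ltn_ord i; have := ltn_ord j'; lia.
Qed.

Definition climbs (m L : nat) (d : nat -> bool) (w : L.+1.-tuple 'I_m.+1) :=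
  [forall p : 'I_L, nth ord0 w p + d p <= nth ord0 w p.+1].

(* Subtracting the number of forced jumps before each position turns the
   condition into weak monotonicity, with the maximum lowered by their total
   number. *)
Lemma card_climbs (m L : nat) (d : nat -> bool) (D := \sum_(p < L) d p) :
  #|[set w : L.+1.-tuple 'I_m.+1 | climbs d w]| =
  if D <= m then 'C(m - D + L.+1, L.+1) else 0.
Proof.
pose S p := \sum_(q < p) d q.
have S_S p : S p.+1 = S p + d p by rewrite /S big_ord_recr.
(* The one-step inequalities from [p] to [q] add up; moving [S p] to the right avoids truncated
   subtraction. *)
have gap (w : L.+1.-tuple 'I_m.+1) : climbs d w ->
    forall q, q <= L -> forall p, p <= q ->
    nth ord0 w p + S q <= nth ord0 w q + S p.
  move=> /forallP w_cl; elim=> [_ p|q IHq lt_qL p]; first by rewrite leqn0 => /eqP->.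
  rewrite leq_eqVlt => /predU1P[-> //|le_pq].
  have := IHq (ltnW lt_qL) p le_pq; have := w_cl (Ordinal lt_qL) => /=.
  by rewrite S_S; lia.
have S0 : S 0 = 0 by rewrite /S big_ord0.
have S_L : S L = D by [].
clearbody S D.
(* Comparing with the two ends of [w] puts [w_p - S p] between [0] and [m - D], so subtracting [S p]
   loses nothing. *)
have bounds (w : L.+1.-tuple 'I_m.+1) : climbs d w -> forall p, p <= L ->
    S p <= nth ord0 w p /\ nth ord0 w p + D <= m + S p.
  move=> w_cl p le_pL; have := gap w w_cl p le_pL 0 (leq0n p).
  have := gap w w_cl L (leqnn L) p le_pL; have := ltn_ord (nth ord0 w L).
  by lia.
case: leqP => [le_Dm|lt_mD]; last first.
  apply/eqP; rewrite cards_eq0; apply/eqP/setP => w; rewrite !inE.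
  by apply/negP => /bounds/(_ L (leqnn L))[]; rewrite S_L; lia.
have S_le p : p <= L -> S p <= D.
  rewrite -S_L => /subnKC <-; elim: (L - p) => [|r IHr]; first by rewrite addn0.
  by rewrite addnS S_S (leq_trans IHr) ?leq_addr.
rewrite addnC -card_sorted_tuples.
pose raise (t : L.+1.-tuple 'I_(m - D).+1) : L.+1.-tuple 'I_m.+1 :=
  [tuple inord (tnth t p + S p) | p < L.+1].
have raiseE t p : p <= L -> nth ord0 (raise t) p = nth ord0 t p + S p :> nat.
  rewrite -ltnS => lt_pL; rewrite -[p]/(val (Ordinal lt_pL)) -!tnth_nth tnth_mktuple.
  rewrite inordK //=; have := ltn_ord (tnth t (Ordinal lt_pL)).
  by have := S_le p lt_pL; lia.
clearbody raise.
have inj_raise : injective raise.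
  move=> t1 t2 eq_t; apply: eq_from_tnth => p; apply: val_inj; rewrite /= !(tnth_nth ord0).
  have:= congr1 (fun t : L.+1.-tuple _ => val (nth ord0 t p)) eq_t.
  have le_pL : p <= L by rewrite -ltnS.
  by rewrite /= !raiseE //; lia.
have lower (w : L.+1.-tuple 'I_m.+1) : climbs d w ->
    exists2 t, sorted leq [seq val i | i <- tval t] & w = raise t.
  move=> w_cl.
  pose t : L.+1.-tuple 'I_(m - D).+1 := [tuple inord (tnth w p - S p) | p < L.+1].
  have tE p : p <= L -> nth ord0 t p = nth ord0 w p - S p :> nat.
    move=> le_pL; have lt_pL : p < L.+1 by [].
    rewrite -[p]/(val (Ordinal lt_pL)) -!tnth_nth tnth_mktuple.
    by rewrite inordK (tnth_nth ord0) /=; case: (bounds w w_cl p le_pL); lia.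
  clearbody t; exists t.
    apply/(sortedP 0) => p; rewrite size_map size_tuple ltnS => lt_pL.
    have le_pL := ltnW lt_pL; rewrite !(nth_map ord0) ?size_tuple //= !tE //.
    have /forallP/(_ (Ordinal lt_pL))/= := w_cl.
    by rewrite S_S; case: (bounds w w_cl p le_pL); lia.
  apply: eq_from_tnth => p; apply: val_inj; rewrite /= !(tnth_nth ord0).
  have le_pL : p <= L by rewrite -ltnS.
  by rewrite raiseE // tE //; case: (bounds w w_cl p le_pL); lia.
have raise_climbs (t : L.+1.-tuple 'I_(m - D).+1) :
    sorted leq [seq val i | i <- tval t] -> climbs d (raise t).
  move=> /(sortedP 0); rewrite size_map size_tuple => t_sorted.
  apply/forallP => p; have lt_pL := ltn_ord p; have := t_sorted p lt_pL.
  have le_pL := ltnW lt_pL; rewrite !(nth_map ord0) ?size_tuple //= !raiseE //.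
  by rewrite S_S; lia.
rewrite -(card_imset _ inj_raise); apply: eq_card => w; rewrite inE.
apply/idP/imsetP => [/lower[t t_sorted ->]|[t]]; first by exists t; rewrite ?inE.
by rewrite inE => t_sorted ->; apply: raise_climbs.
Qed.

(** * Words with their bars attached *)

Section Marked.

Variables (T : eqType) (x0 : T).
Implicit Types (s : seq T) (x : T).

(** The Boolean is the bar of [barred_at]. With it a bipermutation becomes a list without
    repetitions, hence is determined by any strict order that sorts it. *)
Definition marked s : seq (T * bool) :=
  mkseq (fun p => (nth x0 s p, nth x0 s p \in take p s)) (size s).

Lemma size_marked s : size (marked s) = size s.
Proof. exact: size_mkseq. Qed.

Lemma nth_marked l0 s p :
  p < size s -> nth l0 (marked s) p = (nth x0 s p, nth x0 s p \in take p s).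
Proof. exact: nth_mkseq. Qed.

Lemma unzip1_marked s : unzip1 (marked s) = s.
Proof. by rewrite /unzip1 -map_comp -[RHS](mkseq_nth x0). Qed.

Lemma marked_rcons s x : marked (rcons s x) = rcons (marked s) (x, x \in s).
Proof.
rewrite /marked size_rcons mkseqS nth_rcons ltnn eqxx -[rcons s x]cats1 take_size_cat //.
congr (rcons _ _); apply/eq_in_map => p; rewrite mem_iota /= add0n => lt_ps.
by rewrite nth_cat lt_ps takel_cat // ltnW.
Qed.

Lemma mem_marked_false s x : ((x, false) \in marked s) = (x \in s).
Proof.
elim/last_ind: s => // s y IHs; rewrite marked_rcons !mem_rcons !inE IHs.
by rewrite xpair_eqE; case: eqVneq => [->|//]; case: (y \in s).
Qed.

Lemma mem_marked_true s x : ((x, true) \in marked s) = (1 < count_mem x s).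
Proof.
elim/last_ind: s => // s y IHs.
rewrite marked_rcons mem_rcons inE IHs -cats1 count_cat /= addn0 xpair_eqE.
rewrite [y == x]eq_sym; case: eqVneq => [<-|_] /=; last by rewrite addn0.
by rewrite -has_pred1 has_count addn1 ltnS; case: (count_mem x s) => [|[]].
Qed.

(** Every occurrence of a value after the first gets the mark [true], so a repeated marked letter
    takes three occurrences. *)
Lemma marked_uniq s : (forall x, count_mem x s <= 2) -> uniq (marked s).
Proof.
elim/last_ind: s => // s y IHs le2; rewrite marked_rcons rcons_uniq IHs.
  rewrite andbT; have [ys|/negbTE ys] := boolP (y \in s).
    by have:= le2 y; rewrite mem_marked_true -cats1 count_cat /= eqxx; lia.
  by rewrite mem_marked_false ys.
by move=> x; apply: leq_trans (le2 x); rewrite -cats1 count_cat leq_addr.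
Qed.

Lemma marked_precedes l0 s p x : p < size s ->
  nth l0 (marked s) p = (x, true) ->
  exists2 q, q < p & nth l0 (marked s) q = (x, false).
Proof.
move=> lt_ps; rewrite nth_marked // => -[px x_seen].
have xs : x \in s by rewrite -px mem_nth.
have lt_xp : index x s < p by rewrite -in_take // -{1}px.
exists (index x s) => //; rewrite nth_marked ?index_mem // nth_index //.
by congr pair; rewrite in_take // ltnn.
Qed.

(** This reads a word off a sorted list of marked letters. If the value of an unbarred letter at [p]
    occurred earlier, at [q], that occurrence would be barred, and its unbarred copy, earlier still,
    would have to sit at [p]. *)
Lemma marked_unzip1 l0 (D : seq (T * bool)) :
  (forall p q, p < size D -> q < size D -> (nth l0 D p).1 = (nth l0 D q).1 ->
     (nth l0 D p).2 = (nth l0 D q).2 -> p = q) ->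
  (forall p, p < size D -> (nth l0 D p).2 ->
     exists2 q, q < p & nth l0 D q = ((nth l0 D p).1, false)) ->
  marked (unzip1 D) = D.
Proof.
move=> D_inj D_prec; apply: (@eq_from_nth _ l0).
  by rewrite size_marked size_map.
move=> p; rewrite size_marked size_map => lt_pD.
rewrite nth_marked ?size_map // (nth_map l0) //.
rewrite [RHS]surjective_pairing; congr pair; apply/idP/idP => [|D_p].
  rewrite -map_take => /mapP[l /(nthP l0)[q]]; rewrite size_take_min => lt_q.
  have [lt_qp lt_qD] : q < p /\ q < size D by lia.
  rewrite nth_take // => <- eq_pq; apply: contraTT isT => D_p.
  have [Dq|Dq] := boolP (nth l0 D q).2; last first.
    by have := D_inj p q lt_pD lt_qD eq_pq; rewrite (negbTE D_p) (negbTE Dq); lia.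
  have [r lt_rq Dr] := D_prec q lt_qD Dq.
  have lt_rD : r < size D by lia.
  have := D_inj p r lt_pD lt_rD; rewrite Dr /= (negbTE D_p) eq_pq => /(_ erefl erefl).
  by lia.
have [q lt_qp Dq] := D_prec p lt_pD D_p.
rewrite -map_take; apply/mapP; exists (nth l0 D q); last by rewrite Dq.
by rewrite -(nth_take _ lt_qp) mem_nth // size_take_min leq_min lt_qp (ltn_trans lt_qp).
Qed.

End Marked.

(** * The alphabet of marked letters and its tie-breaking order *)

Section Letters.

Variables (n : nat) (k : 'I_n).
Implicit Types (i : 'I_n) (l : 'I_n * bool) (s : seq ('I_n * bool)).

(** The single occurrence of [k] is a first occurrence, hence marked [false]; [(k, true)] is the one
    marked letter that never appears. *)
Definition letters := enum (predC1 (k, true)).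

Lemma size_letters : size letters = n.*2.-1.
Proof. by rewrite -cardE cardC1 card_prod card_ord card_bool muln2. Qed.

Lemma mem_letters l : (l \in letters) = (l != (k, true)).
Proof. by rewrite mem_enum. Qed.

Lemma count_letters i s : perm_eq s letters ->
  count_mem i (unzip1 s) = if i == k then 1 else 2.
Proof.
move=> /permP s_perm; rewrite count_map s_perm.
pose t := (i, false) :: if i == k then [::] else [:: (i, true)].
have t_uniq : uniq t by rewrite /t; case: ifP => //= _; rewrite inE xpair_eqE andbF.
have -> : (if i == k then 1 else 2) = size t by rewrite /t; case: ifP.
rewrite -(card_uniqP t_uniq) -size_filter /letters.
rewrite {1}/enum_mem -filter_predI -/(enum_mem _) -cardE.
apply: eq_card => -[j b]; rewrite unfold_in /t /= !inE !xpair_eqE.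
case: (eqVneq i k) => [ik|/negbTE ik]; rewrite ?inE ?xpair_eqE /=;
  by case: (eqVneq j i) => [->|_]; rewrite ?ik ?eqxx; case: b.
Qed.

(** The marked word has no repetition, avoids [(k, true)] and is as long as the alphabet, so it
    exhausts it. *)
Lemma perm_marked (B : n.*2.-1.-tuple 'I_n) :
  (forall i, count_mem i B = if i == k then 1 else 2) ->
  perm_eq (marked k B) letters.
Proof.
move=> cntB.
have B_uniq : uniq (marked k B) by apply: marked_uniq => i; rewrite cntB; case: ifP.
apply: uniq_perm => //; first exact: enum_uniq.
apply: (uniq_min_size B_uniq _ _).2 => [l lB|].
  rewrite mem_letters; apply/eqP => l_k; move: lB.
  by rewrite l_k mem_marked_true cntB eqxx.
by rewrite size_letters size_marked size_tuple.
Qed.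

(* Among letters with equal values, non-descents are exactly the steps up in
   the order: unbarred i < k, increasing; then barred letters, decreasing, with
   k at its place among them; then unbarred i > k, increasing. *)
Definition rank l : nat :=
  if (l.1 == k) || l.2 then n.*2 - l.1
  else if l.1 < k then (l.1 : nat) else n.*2.+1 + l.1.

Lemma rank_lt l : rank l < 4 * n.
Proof.
have := ltn_ord l.1; have := ltn_ord k; rewrite /rank.
by case: ifP => _; [|case: ifP => _]; lia.
Qed.

(** The three blocks of [rank] do not overlap: their values lie below [n], from [n + 1] to [2n], and
    above [2n]. The excluded [(k, true)] would share the rank of [(k, false)]. *)
Lemma rank_inj : {in predC1 (k, true) &, injective rank}.
Proof.
suff inj (i j : 'I_n) (b c : bool) : (i, b) != (k, true) -> (j, c) != (k, true) ->
    rank (i, b) = rank (j, c) -> (i, b) = (j, c).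
  by move=> [i b] [j c]; apply: inj.
rewrite !xpair_eqE /rank /= => ik jk eq_r.
suff: (i = j :> nat) /\ b = c by case=> /val_inj -> ->.
have [[lt_in lt_jn] lt_kn] := (ltn_ord i, ltn_ord j, ltn_ord k).
move: ik jk eq_r; rewrite -!val_eqE /=; case: b; case: c;
  rewrite ?andbT ?andbF ?orbT ?orbF /=; do ?case: ifP; by lia.
Qed.

Lemma descent_pair_rank l1 l2 :
  l1 != (k, true) -> l2 != (k, true) -> l1 != l2 ->
  descent_pair k l1.1 l1.2 l2.1 l2.2 = (rank l2 < rank l1).
Proof.
case: l1 l2 => [i b] [j c]; rewrite !xpair_eqE /rank /descent_pair /=.
have [[lt_in lt_jn] lt_kn] := (ltn_ord i, ltn_ord j, ltn_ord k).
rewrite -!val_eqE /=; case: b; case: c; rewrite ?andbT ?andbF ?orbT ?orbF /=;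
  by case: (ltngtP i k); case: (ltngtP j k) => /=; lia.
Qed.

(** The lexicographic order by value, then rank, packed into one number: [4 * n] exceeds every
    rank. *)
Definition key (v : 'I_n * bool -> nat) l := v l * (4 * n) + rank l.

Lemma key_inj v : {in predC1 (k, true) &, injective (key v)}.
Proof.
move=> l1 l2 k1 k2 /(congr1 (modn^~ (4 * n))).
by rewrite /key !modnMDl !modn_small ?rank_lt //; apply: rank_inj.
Qed.

(** At equal values the keys compare as the ranks, so such a step is allowed exactly when it is not
    a descent; at a descent the value itself has to increase. *)
Lemma key_ltn v l1 l2 :
  l1 != (k, true) -> l2 != (k, true) -> l1 != l2 ->
  (key v l1 < key v l2) = (v l1 + descent_pair k l1.1 l1.2 l2.1 l2.2 <= v l2).
Proof.
move=> k1 k2 l12; rewrite descent_pair_rank // /key.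
have := rank_lt l1; have := rank_lt l2.
have : rank l1 <> rank l2.
  by move/(rank_inj k1 k2)/eqP; rewrite (negbTE l12).
by case: (ltngtP (v l1) (v l2)) => [||->]; case: ltngtP => //=; nia.
Qed.

(** Simultaneous copies of [i] come in the right order only if [i < k]. This is why [k] has to be
    the last index attaining the maximum. *)
Lemma rank_bar i : i != k -> (rank (i, false) < rank (i, true)) = (i < k).
Proof.
move=> ik; have [lt_in lt_kn] := (ltn_ord i, ltn_ord k).
by rewrite /rank /= (negbTE ik) orbT /=; case: ifP; lia.
Qed.

End Letters.

Lemma climbs_mono (m L : nat) (d : nat -> bool) (w : L.+1.-tuple 'I_m.+1) p q :
  climbs d w -> p <= q <= L -> nth ord0 w p <= nth ord0 w q.
Proof.
move=> /forallP w_cl /andP[le_pq]; move: le_pq => /subnKC <-.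
elim: (q - p) => [|r IHr]; first by rewrite addn0.
rewrite addnS => lt_pL; apply: leq_trans (IHr (ltnW lt_pL)) _.
exact: leq_trans (leq_addr _ _) (w_cl (Ordinal lt_pL)).
Qed.

(** * The correspondence between pairs [(B, w)] and functions [f] *)

Section Profiles.

Variables n m : nat.
Notation N := n.*2.-1.
Implicit Types (k i : 'I_n) (B : N.-tuple 'I_n) (w : N.+1.-tuple 'I_m.+1).
Implicit Types (f : {ffun 'I_n -> 'I_m.+1 * 'I_m.+1}) (l : 'I_n * bool).

Definition multiplicities k B :=
  forall i, count_mem i B = if i == k then 1 else 2.

(** Since all letters but one occur twice, [pick] has only one possible answer. *)
Lemma single_letterP k B :
  reflect (is_biperm B /\ single_letter B = Some k)
          [forall i, count_mem i B == if i == k then 1 else 2].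
Proof.
apply: (iffP forallP) => [cntB|[/existsP[k' /andP[/eqP cntk' /forallP cntB]]]].
  split.
    apply/existsP; exists k; rewrite (eqP (cntB k)) eqxx /=.
    by apply/forallP => i; apply/implyP => /negbTE ik; have := cntB i; rewrite ik.
  rewrite /single_letter.
  case: pickP => [j|/(_ k)]; rewrite (eqP (cntB _)) ?eqxx //.
  by case: (eqVneq j k) => [->|].
rewrite /single_letter; case: pickP => // j /eqP cntj [<-] i.
have eq_k' i' : count_mem i' B = 1 -> i' = k'.
  by case: (eqVneq i' k') (implyP (cntB i')) => // _ /(_ isT)/eqP->.
case: (eqVneq i j) => [->|]; first by rewrite cntj.
by rewrite (eq_k' j cntj) => ik'; apply: (implyP (cntB i)).
Qed.

(** [w] has one more term than [B] has letters. The guard makes its last step, from the last letter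
    to the final value [M], a weak one. *)
Definition jumps k B p : bool := (p < n.*2.-2) && descent_at k B p.

Lemma sum_jumps k B : \sum_(p < N) jumps k B p =
  #|[set p : 'I_(n.*2.-2) | descent_at k B p]|.
Proof.
have n_gt0 : 0 < n by case: (n) k => [[]|].
rewrite -sum1dep_card [RHS]big_mkcond /= -(big_mkord predT (fun p => jumps k B p : nat)).
have -> : N = n.*2.-2.+1 by lia.
rewrite big_nat_recr //= {2}/jumps ltnn addn0 big_mkord.
by apply: eq_bigr => p _; rewrite /jumps ltn_ord; case: descent_at.
Qed.

(** Between consecutive letters this is [key_ltn]; the remaining step, to the last term of [w], is
    covered by [w_max]. *)
Lemma climbs_sorted_keys k B w (v : 'I_n * bool -> nat) :
  multiplicities k B ->
  (forall p, p < N -> v (nth (k, false) (marked k B) p) = nth ord0 w p) ->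
  (forall p, p < N -> nth ord0 w p <= nth ord0 w N) ->
  climbs (jumps k B) w = sorted (relpre (key k v) ltn) (marked k B).
Proof.
move=> cntB vE w_max; have D_perm := perm_marked cntB.
have D_uniq : uniq (marked k B) by rewrite (perm_uniq D_perm) enum_uniq.
have szD : size (marked k B) = N by rewrite size_marked size_tuple.
have step p : p.+1 < N -> (key k v (nth (k, false) (marked k B) p) <
      key k v (nth (k, false) (marked k B) p.+1)) =
    (nth ord0 w p + jumps k B p <= nth ord0 w p.+1).
  move=> lt_pN; have lt_pN' := ltnW lt_pN.
  have Dk q : q < N -> nth (k, false) (marked k B) q != (k, true).
    by move=> lt_qN; rewrite -mem_letters -(perm_mem D_perm) mem_nth ?szD.
  rewrite key_ltn ?Dk ?nth_uniq ?szD ?(ltn_eqF (ltnSn p)) // !vE //.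
  rewrite !nth_marked ?size_tuple // /jumps.
  by have -> : p < n.*2.-2 by lia.
apply/forallP/(sortedP (k, false)) => [w_cl p|D_sorted [p lt_pN]] /=.
  by rewrite szD => lt_pN; rewrite step //; have := w_cl (Ordinal (ltnW lt_pN)).
have [lt_p1N|ge_p1N] := ltnP p.+1 N; first by rewrite -step //; apply: D_sorted; rewrite szD.
rewrite /jumps (_ : (p < _) = false) ?addn0; last by lia.
have pN : p.+1 = N by lia.
by rewrite pN; apply: w_max.
Qed.

(** The pairs [(x_i, z_i)], where [z_i] is the time left after the second occurrence of [i]. The
    mark [i != k] selects that occurrence, or the only one when [i] is [k]. *)
Definition profile k B w : {ffun 'I_n -> 'I_m.+1 * 'I_m.+1} :=
  [ffun i => (nth ord0 w (index (i, false) (marked k B)),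
    inord (nth ord0 w N - nth ord0 w (index (i, i != k) (marked k B))))].

(** The reverse reading of a profile: the time at which a marked letter occurs. *)
Definition level f (M : nat) l : nat := if l.2 then M - (f l.1).2 else (f l.1).1.

(** Strictness beyond [k] makes it the last index attaining the maximum, so [f] alone determines [M]
    and [k]. *)
Definition dominant f (M : nat) k :=
  [/\ forall i, (f i).1 + (f i).2 <= M, (f k).1 + (f k).2 = M :> nat
    & forall i, k < i -> (f i).1 + (f i).2 < M].

Lemma dominant_unique f M k M' k' :
  dominant f M k -> dominant f M' k' -> M = M' /\ k = k'.
Proof.
move=> [le_M eq_M lt_M] [le_M' eq_M' lt_M'].
have eq_MM' : M = M' by have := le_M k'; have := le_M' k; lia.
split=> //; apply: val_inj => /=.
by case: (ltngtP k k') => [/lt_M|/lt_M'|//]; lia.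
Qed.

Lemma dominant_exists f : 0 < n -> exists M k, dominant f M k.
Proof.
move=> n_gt0; pose i0 := Ordinal n_gt0.
pose M := \max_i ((f i).1 + (f i).2).
have [i1 eq_M] : {i1 | M = (f i1).1 + (f i1).2}.
  by apply: eq_bigmax; rewrite card_ord.
have le_M i : (f i).1 + (f i).2 <= M by apply: (leq_bigmax i).
have Pi1 : (f i1).1 + (f i1).2 == M by rewrite eq_M.
exists M; case: (@arg_maxnP _ i1 (fun i => (f i).1 + (f i).2 == M) val Pi1).
move=> k /eqP eq_k k_max; exists k; split=> // i lt_ki.
rewrite ltn_neqAle le_M andbT; apply/negP => /k_max /=.
by rewrite leqNgt lt_ki.
Qed.

(** * What the profile of a pair [(B, w)] remembers *)

Section Encode.

Variables (k : 'I_n) (B : N.-tuple 'I_n) (w : N.+1.-tuple 'I_m.+1).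
Hypotheses (cntB : multiplicities k B) (w_cl : climbs (jumps k B) w).

Let f := profile k B w.
Let M : nat := nth ord0 w N.
Let D := marked k B.

Let w_le p : p < N -> nth ord0 w p <= M.
Proof. by move=> lt_pN; apply: (climbs_mono w_cl); rewrite ltnW //=. Qed.

Let szD : size D = N. Proof. by rewrite size_marked size_tuple. Qed.

Let D_uniq : uniq D.
Proof. by rewrite (perm_uniq (perm_marked cntB)) enum_uniq. Qed.

Let mem_D l : (l \in D) = (l != (k, true)).
Proof. by rewrite (perm_mem (perm_marked cntB)) mem_letters. Qed.

Let index_lt l : l != (k, true) -> index l D < N.
Proof. by rewrite -mem_D -szD index_mem. Qed.

Let index_false_true i :
  (i, true) != (k, true) -> index (i, false) D < index (i, true) D.
Proof.
move=> i_true; have lt_T := index_lt i_true.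
have := @marked_precedes _ k (k, false) B (index (i, true) D) i.
rewrite size_tuple nth_index ?mem_D // => /(_ lt_T erefl)[q lt_q <-].
by rewrite index_uniq ?szD // (ltn_trans lt_q).
Qed.

Let fE1 i : (f i).1 = nth ord0 w (index (i, false) D).
Proof. by rewrite ffunE. Qed.

Let fE2 i : (f i).2 = M - nth ord0 w (index (i, i != k) D) :> nat.
Proof.
rewrite ffunE /= inordK //; apply: leq_ltn_trans (leq_subr _ _) _.
exact: ltn_ord.
Qed.

Lemma level_profile p : p < N -> level f M (nth (k, false) D p) = nth ord0 w p.
Proof.
move=> lt_pN; have : nth (k, false) D p != (k, true).
  by rewrite -mem_D mem_nth ?szD.
have: index (nth (k, false) D p) D = p by rewrite index_uniq ?szD.
rewrite /level; case: (nth _ D p) => i [] /= <-; last by rewrite fE1.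
rewrite xpair_eqE andbT fE2 => ik; rewrite ik subKn // w_le // index_lt //.
by rewrite xpair_eqE (negbTE ik).
Qed.

Let level_index l : l != (k, true) -> level f M l = nth ord0 w (index l D).
Proof. by move=> lk; rewrite -level_profile ?index_lt // nth_index ?mem_D. Qed.

Lemma sorted_profile_keys : sorted (relpre (key k (level f M)) ltn) D.
Proof. by rewrite -(@climbs_sorted_keys _ _ w) //; apply: level_profile. Qed.

(** The bounds by [M] come from monotonicity of [w]. For [i > k] the barred copy comes later
    although its rank is smaller, so the keys can increase only if the time strictly increases. *)
Lemma dominant_profile : dominant f M k.
Proof.
have w_lt i : k < i ->
    nth ord0 w (index (i, false) D) < nth ord0 w (index (i, true) D).
  move=> lt_ki; have ik : i != k by rewrite -val_eqE /= gtn_eqF.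
  have i_false : (i, false) != (k, true) by rewrite xpair_eqE andbF.
  have i_true : (i, true) != (k, true) by rewrite xpair_eqE (negbTE ik).
  have lt_keys : key k (level f M) (i, false) < key k (level f M) (i, true).
    have [lt_F lt_T] := (index_lt i_false, index_lt i_true).
    have lt_ind := index_false_true i_true.
    have := sorted_ltn_nth _ (k, false) sorted_profile_keys.
    move=> /(_ _ (index (i, false) D) (index (i, true) D)).
    rewrite !inE szD !nth_index ?mem_D //; apply=> //.
    by move=> l1 l2 l3 /=; apply: ltn_trans.
  have desc : rank k (i, true) < rank k (i, false).
    have := rank_bar ik; rewrite (ltnNge i) (ltnW lt_ki) /=.
    by case: ltngtP => // /rank_inj; rewrite !inE => /(_ i_false i_true).
  move: lt_keys; rewrite key_ltn // ?xpair_eqE ?eqxx //.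
  rewrite descent_pair_rank // ?xpair_eqE ?eqxx // desc addn1.
  by rewrite !level_index.
have i_false i : (i, false) != (k, true) by rewrite xpair_eqE andbF.
split=> [i||i lt_ki].
- rewrite fE1 fE2; case: (eqVneq i k) => [_|ik] /=.
    by have := w_le (index_lt (i_false i)); lia.
  have i_true : (i, true) != (k, true) by rewrite xpair_eqE (negbTE ik).
  have [lt_F lt_T] := (index_lt (i_false i), index_lt i_true).
  have : nth ord0 w (index (i, false) D) <= nth ord0 w (index (i, true) D).
    apply: (climbs_mono w_cl); rewrite (ltnW lt_T) andbT ltnW //.
    exact: index_false_true.
  by have := w_le lt_T; lia.
- by rewrite fE1 fE2 eqxx /=; have := w_le (index_lt (i_false k)); lia.
have ik : i != k by rewrite -val_eqE /= gtn_eqF.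
have i_true : (i, true) != (k, true) by rewrite xpair_eqE (negbTE ik).
rewrite fE1 fE2 ik; have := w_lt i lt_ki; have := w_le (index_lt i_true).
lia.
Qed.

End Encode.

(** Dominance recovers [M] and [k], hence all keys. The alphabet has only one strictly sorted
    listing, which gives [B]; the levels and [M] then give [w]. *)
Lemma profile_inj k B w k' B' w' :
  multiplicities k B -> climbs (jumps k B) w ->
  multiplicities k' B' -> climbs (jumps k' B') w' ->
  profile k B w = profile k' B' w' -> B = B' /\ w = w'.
Proof.
move=> cntB w_cl cntB' w_cl' eq_f.
have dom := dominant_profile cntB w_cl; have dom' := dominant_profile cntB' w_cl'.
rewrite -eq_f in dom'; have [eq_M eq_k] := dominant_unique dom dom'.
subst k'.
have D_sorted := sorted_profile_keys cntB w_cl.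
have D_sorted' := sorted_profile_keys cntB' w_cl'.
rewrite -eq_f -eq_M in D_sorted'.
have eq_D : marked k B = marked k B'.
  apply: irr_sorted_eq D_sorted D_sorted' _ => [l1 l2 l3|l|l] /=.
  - exact: ltn_trans.
  - exact: ltnn.
  - by rewrite (perm_mem (perm_marked cntB)) (perm_mem (perm_marked cntB')).
have eq_B : B = B'.
  by apply: val_inj; rewrite /= -(unzip1_marked k B) eq_D unzip1_marked.
subst B'; split=> //; apply: eq_from_tnth => p; apply: val_inj => /=.
rewrite !(tnth_nth ord0); have := ltn_ord p; rewrite ltnS leq_eqVlt.
case/predU1P => [->//|lt_pN].
rewrite -(level_profile cntB w_cl) // -(level_profile cntB w_cl') //.
by rewrite -eq_f -eq_M.
Qed.

(** The preimage is built by sorting the alphabet by key: [B] is the sorted list without its bars,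
    and [w] lists the levels, followed by [M]. *)
Lemma profile_surj f : 0 < n -> (forall i, (f i).1 + (f i).2 <= m) ->
  exists k B w,
    [/\ multiplicities k B, climbs (jumps k B) w & profile k B w = f].
Proof.
move=> n_gt0 f_le; have [M [k [le_M eq_M lt_M]]] := dominant_exists f n_gt0.
have le_Mm : M <= m by rewrite -eq_M.
pose v := level f M.
have v_le l : v l <= M.
  by rewrite /v /level; case: ifP => _; [lia | have := le_M l.1; lia].
pose D := sort (relpre (key k v) leq) (letters k).
have D_perm : perm_eq D (letters k) by rewrite perm_sort.
have D_uniq : uniq D by rewrite (perm_uniq D_perm) enum_uniq.
have szD : size D = N by rewrite (perm_size D_perm) size_letters.
have mem_D l : (l \in D) = (l != (k, true)).
  by rewrite (perm_mem D_perm) mem_letters.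
have D_sorted : sorted (relpre (key k v) ltn) D.
  rewrite -sorted_map ltn_sorted_uniq_leq; apply/andP; split.
    rewrite map_inj_in_uniq // => l1 l2; rewrite !mem_D => k1 k2.
    by apply: key_inj; rewrite inE.
  rewrite sorted_map; apply: sort_sorted => l1 l2; exact: leq_total.
(* For [i < k] a tie in time is resolved correctly by the rank; for [i > k] dominance excludes a
   tie. *)
have key_lt i : i != k -> key k v (i, false) < key k v (i, true).
  move=> ik; have i_false : (i, false) != (k, true) by rewrite xpair_eqE andbF.
  have i_true : (i, true) != (k, true) by rewrite xpair_eqE (negbTE ik).
  rewrite key_ltn // ?descent_pair_rank // ?xpair_eqE ?eqxx //.
  have := rank_bar ik; have := lt_M i; have le_Mi := le_M i.
  rewrite /v /level /=; case: (ltngtP i k) => [lt_ik|lt_ki|/val_inj eq_ik].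
  - by move=> _ rank_lt; rewrite ltnNge (ltnW rank_lt) /=; lia.
  - by move=> /(_ isT) lt_Mi _; case: ltnP => _ /=; lia.
  - by rewrite eq_ik eqxx in ik.
have marked_D : marked k (unzip1 D) = D.
  apply: (@marked_unzip1 _ _ (k, false)) => [p q lt_p lt_q eq1 eq2|p lt_p Dp2].
    apply/eqP; rewrite -(nth_uniq (k, false) lt_p lt_q D_uniq).
    by rewrite [nth _ _ p]surjective_pairing [nth _ _ q]surjective_pairing eq1 eq2.
  case Dp: (nth (k, false) D p) Dp2 => [i b] /= b_true; rewrite {}b_true in Dp.
  have ik : i != k.
    have := mem_nth (k, false) lt_p; rewrite Dp mem_D xpair_eqE.
    by case: eqVneq.
  have i_D : (i, false) \in D by rewrite mem_D xpair_eqE andbF.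
  exists (index (i, false) D); last by rewrite nth_index.
  rewrite ltnNge; apply/negP => le_p; have := key_lt i ik; rewrite ltnNge.
  move/negP; apply; rewrite -Dp -[(i, false)](nth_index (k, false) i_D).
  have D_sorted_le : sorted (relpre (key k v) leq) D.
    by apply: sort_sorted => l1 l2; apply: leq_total.
  apply: (sorted_leq_nth _ _ (k, false) D_sorted_le) => //.
  - by move=> l1 l2 l3 /=; apply: leq_trans.
  - by move=> l /=.
  - by rewrite inE index_mem.
have szB : size (unzip1 D) == N by rewrite size_map szD.
pose B : N.-tuple 'I_n := Tuple szB.
have szw : size (rcons [seq inord (v l) : 'I_m.+1 | l <- D] (inord M)) == N.+1.
  by rewrite size_rcons size_map szD.
pose w : N.+1.-tuple 'I_m.+1 := Tuple szw.
have cntB : multiplicities k B by move=> i; rewrite -(count_letters i D_perm).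
have wE p : p < N -> nth ord0 w p = v (nth (k, false) D p) :> nat.
  move=> lt_pN; rewrite nth_rcons size_map szD lt_pN (nth_map (k, false)) ?szD //.
  by rewrite inordK // ltnS (leq_trans (v_le _)).
have wN : nth ord0 w N = M :> nat.
  by rewrite nth_rcons size_map szD ltnn eqxx inordK.
have w_index l : l != (k, true) -> nth ord0 w (index l D) = v l :> nat.
  by rewrite -mem_D => lD; rewrite wE -?szD ?index_mem // nth_index.
exists k, B, w; split=> //.
  rewrite (@climbs_sorted_keys _ _ _ v) //.
  - by rewrite marked_D.
  - by move=> p lt_pN; rewrite marked_D wE.
  - by move=> p lt_pN; rewrite wE // wN.
apply/ffunP => i; rewrite ffunE marked_D [RHS]surjective_pairing.
have i_false : (i, false) != (k, true) by rewrite xpair_eqE andbF.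
congr pair; apply: val_inj => /=; first by rewrite w_index.
(* For [k] itself, [x_k + z_k = M] recovers [z_k] from the single occurrence. *)
case: (eqVneq i k) => [ik|ik] /=.
  by rewrite wN w_index // /v /level /= inordK ik -eq_M addKn // ltn_ord.
have i_true : (i, true) != (k, true) by rewrite xpair_eqE (negbTE ik).
rewrite wN w_index // /v /level /= subKn ?inordK ?ltn_ord //.
by apply: leq_trans (le_M i); rewrite leq_addl.
Qed.

(** A double count of [X]: [G] maps it bijectively onto the functions with values in [P], and
    [card_climbs] counts the pairs with a given [B]. *)
Lemma sum_biperms : 0 < n ->
  \sum_(B : N.-tuple 'I_n | is_biperm B)
    (if descents B <= m then 'C(m - descents B + n.*2, n.*2) else 0)
  = 'C(m + 2, 2) ^ n.
Proof.
move=> n_gt0.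
pose good (c : N.-tuple 'I_n * N.+1.-tuple 'I_m.+1) :=
  if single_letter c.1 is Some k then climbs (jumps k c.1) c.2 else false.
pose G (c : N.-tuple 'I_n * N.+1.-tuple 'I_m.+1) :=
  if single_letter c.1 is Some k then profile k c.1 c.2
  else [ffun=> (ord0, ord0)].
pose X := [set c : N.-tuple 'I_n * N.+1.-tuple 'I_m.+1 | is_biperm c.1 & good c].
pose P := [set c : 'I_m.+1 * 'I_m.+1 | c.1 + c.2 <= m].
have biperm_single B : is_biperm B -> exists2 k, single_letter B = Some k &
    multiplicities k B.
  move=> B_bi; have [k /andP[cntk _]] := existsP B_bi.
  case Bk: (single_letter B) => [k'|]; last first.
    by move: Bk; rewrite /single_letter; case: pickP => // /(_ k); rewrite cntk.
  exists k' => // i.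
  have /forallP/(_ i)/eqP := introT (single_letterP k' B) (conj B_bi Bk).
  exact.
have -> : 'C(m + 2, 2) ^ n = #|X|.
  rewrite -card_le_sum_pairs -/P -[in LHS](card_ord n) -card_ffun_on.
  rewrite -(@card_in_imset _ _ G X).
    apply: eq_card => f; apply/ffun_onP/imsetP => [f_P|[[B w]]].
      have [|k [B [w [cntB w_cl <-]]]] := @profile_surj f n_gt0.
        by move=> i; have := f_P i; rewrite inE.
      have [|B_bi Bk] := elimT (single_letterP k B).
        by apply/forallP => i; rewrite cntB.
      by exists (B, w); rewrite ?inE /G /good /= Bk ?B_bi.
    rewrite inE /G /good /= => /andP[/biperm_single[k -> cntB] w_cl] -> i.
    have [le_M _ _] := dominant_profile cntB w_cl.
    by rewrite inE (leq_trans (le_M i)) // -ltnS ltn_ord.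
  move=> [B w] [B' w']; rewrite !inE /G /good /=.
  move=> /andP[/biperm_single[k -> cntB] w_cl].
  move=> /andP[/biperm_single[k' -> cntB'] w_cl'].
  by move=> /(profile_inj cntB w_cl cntB' w_cl')[-> ->].
rewrite -sum1dep_card -(pair_big_dep _ (fun B w => good (B, w)) (fun _ _ => 1)) /=.
apply: eq_bigr => B /biperm_single[k Bk _].
rewrite sum1dep_card /good /descents /= Bk card_climbs sum_jumps.
by have -> : N.+1 = n.*2 by lia.
Qed.

End Profiles.

(** * Power series: inverting powers of [1 - x] and comparing coefficients *)

Lemma descents_le n (B : n.*2.-1.-tuple 'I_n) : descents B <= n.*2.-2.
Proof.
rewrite /descents; case: (single_letter B) => // k.
by rewrite -[leqRHS]card_ord max_card.
Qed.

Local Open Scope ring_scope.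

(** As [g 0] is a unit, coefficient [m] of the product determines [h m] from the earlier
    coefficients of [h]. *)
Lemma fps_inv_unique (R : unitRingType) (g h : fps R) :
  g 0%N \is a GRing.unit -> fps_mul g h =1 fps_one R -> fps_inv g =1 h.
Proof.
move=> g0U ghE; elim/ltn_ind=> m IHm.
have:= ghE m; rewrite -(fps_mulfV g0U m) /fps_mul !big_ord_recl /= subn0.
rewrite (eq_bigr (fun i : 'I_m => g (bump 0 i) * fps_inv g (m - bump 0 i)%N)).
  by move/addIr/(mulrI g0U).
by move=> i _; rewrite IHm //= /bump /=; have := ltn_ord i; lia.
Qed.

(** A truncated binomial series, stated for polynomials so that ring identities apply. Multiplying
    by [1 - 'X] takes differences of coefficients, and Pascal's rule lowers [d]. *)
Lemma inv_pow_one_minus_X_mod (d M : nat) : exists r : {poly int},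
  (1 - 'X) ^+ d.+1 * \poly_(j < M.+1) ('C(j + d, d))%:R = 1 + 'X^(M.+1) * r.
Proof.
elim: d => [|d [r IHd]].
  exists (-1); rewrite expr1 -[1 - 'X]opprB mulNr.
  under eq_poly => j _ do rewrite bin0.
  rewrite -[X in _ * X](_ : \sum_(i < M.+1) 'X^i = _); last first.
    by rewrite poly_def; apply: eq_bigr => i _; rewrite scale1r.
  by rewrite -subrX1 mulrN1 opprB.
(* The correction to [r] is the boundary term in degree [M + 1] that truncation leaves in the
   difference. *)
exists (r - (1 - 'X) ^+ d.+1 * ('C(M.+1 + d, d.+1))%:R).
rewrite exprSr -mulrA.
have -> : (1 - 'X) * \poly_(j < M.+1) ('C(j + d.+1, d.+1))%:R =
  \poly_(j < M.+1) ('C(j + d, d))%:R - 'X^(M.+1) * ('C(M.+1 + d, d.+1))%:R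
     :> {poly int}.
  apply/polyP=> j; rewrite mulr_natr mulrBl mul1r !coefB coefXM coefMn coefXn.
  rewrite !coef_poly.
  case: j => [|j] /=; first by rewrite !add0n !binn /= mul0rn.
  rewrite !ltnS eqSS; case: (ltngtP j M) => [lt_jM|gt_jM|->] /=.
  - by rewrite mul0rn subr0 addnS binS addSn addnS natrD addrC addKr.
  - by rewrite mul0rn !subr0.
  - by rewrite addnS addSn mulr1n.
by rewrite !mulrBr IHd addrA mulrCA.
Qed.

Lemma fps_inv_pow_one_minus_X (d : nat) :
  fps_inv (fps_of_poly ((1 - 'X) ^+ d.+1 : {poly int})) =1
  (fun j => ('C(j + d, d))%:R).
Proof.
apply: fps_inv_unique.
  rewrite /fps_of_poly -horner_coef0 horner_exp hornerD hornerN hornerX.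
  by rewrite hornerC subr0 expr1n unitr1.
move=> m; rewrite /fps_mul /fps_of_poly /fps_one.
(* Truncating at [m] itself suffices: the remainder starts in degree [m + 1]. *)
have [r /(congr1 (fun p : {poly int} => p`_m))] := inv_pow_one_minus_X_mod d m.
rewrite coefM coefD coef1 coefXnM ltnSn addr0 => <-.
by apply: eq_bigr => i _; rewrite coef_poly ltnS leq_subr.
Qed.

Lemma coef_biEulerian n i : (0 < n)%N ->
  (biEulerian n)`_i = (biEulerian_number n i)%:R.
Proof.
move=> n_gt0; rewrite coef_poly; case: ltnP => // le_i.
rewrite [biEulerian_number n i](_ : _ = 0%N) //; apply/eqP.
rewrite cards_eq0; apply/eqP/setP => B; rewrite !inE; apply/negbTE.
by rewrite negb_and neq_ltn (leq_ltn_trans (descents_le B)) ?orbT //; lia.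
Qed.

Theorem theorem6p2 (n : nat) (n_ge2 : (2 <= n)%N) :
  fps_div (fps_of_poly (biEulerian n)) (fps_of_poly ((1 - 'X) ^+ (2 * n + 1)))
  =1 (fun k : nat => ('C(k + 2, 2) ^ n)%N%:R).
Proof.
have n_gt0 := ltnW n_ge2; move=> m.
rewrite -(sum_biperms m n_gt0) /fps_div /fps_mul addn1 mul2n.
under eq_bigr => i _ do
  rewrite fps_inv_pow_one_minus_X /fps_of_poly coef_biEulerian // -natrM.
rewrite -natr_sum; congr _%:R.
under eq_bigr => i _ do rewrite /biEulerian_number -sum1dep_card big_distrl /=.
(* Each contribution is spread over all degrees [i <= m], only [i = descents B] being nonzero, so
   that the sums over [B] and [i] can be exchanged. *)
under [RHS]eq_bigr => B _.
  rewrite (_ : (if _ then _ else _) = \sum_(i < m.+1 | descents B == i)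
      1 * 'C(m - i + n.*2, n.*2))%N; last first.
    case: leqP => [le_dm|lt_md].
      by rewrite (big_pred1 (Ordinal (le_dm : descents B < m.+1)%N)) ?mul1n.
    rewrite big_pred0 // => i; apply/negbTE.
    by rewrite neq_ltn (leq_trans (ltn_ord i) lt_md) orbT.
  over.
by rewrite [RHS](exchange_big_dep predT) //=.
Qed.
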